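(* (1) Let $B=B(F)$ be a stationary generalized Bratteli diagram such that the incidence matrix $F$ (and therefore $A=F^T$) is irreducible, aperiodic, and recurrent. Then there exists a tail invariant measure $\mu$ on the path-space $X_B$. (2) The measure $\mu$ is finite if and only if the right eigenvector $t=(t_v)$ (of $A$, corresponding to the Perron--Frobenius eigenvalue $\lambda$, i.e. $At=\lambda t$) has the property $\sum_v t_v<\infty$.
   Context: A generalized Bratteli diagram $B=(V,E)$ is a graded graph with $V=\bigsqcup_{n\ge0}V_n$, each $V_n$ being a copy of a fixed countably infinite set $V_0$, and $E=\bigsqcup_{n\ge 0}E_n$, where $E_n$ is the set of edges between $V_n$ and $V_{n+1}$. Each $e\in E_n$ has a source $s(e)\in V_n$ and a range $r(e)\in V_{n+1}$. For $w\in V_n$, $v\in V_{n+1}$ the set $E(w,v)$ of edges with source $w$ and range $v$ is finite (possibly empty), and $f^{(n)}_{vw}=|E(w,v)|$. The incidence matrix $F_n=(f^{(n)}_{vw}: v\in V_{n+1}, w\in V_n)$ has only finitely many non-zero entries in each row and has no zero row and no zero column. The diagram is stationary, written $B(F)$, if $F_n=F$ for all $n\ge 0$ (all levels being identified with one vertex set, e.g. $\mathbb Z$). The path-space $X_B$ is the set of infinite paths $x=(x_i)_{i\ge0}$, $x_i\in E_i$, $r(x_i)=s(x_{i+1})$, with the topology whose base consists of the cylinder sets $[\overline e]=\{x\in X_B: x_0=e_0,\dots,x_n=e_n\}$, where $\overline e=(e_0,\dots,e_n)$ is a finite path. A Borel measure $\mu$ on $X_B$ is tail invariant if $\mu([\overline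 e])=\mu([\overline e'])$ for any two finite paths $\overline e,\overline e'$ starting in $V_0$ with the same terminal vertex (at the same level). For a countable non-negative matrix $A$, let $a^{(n)}_{ij}$ be the entries of $A^n$. $A$ is irreducible if for all $i,j$ there is $n$ with $a^{(n)}_{ij}>0$; an irreducible $A$ is aperiodic if $\gcd\{\ell: a^{(\ell)}_{ii}>0\}=1$ for all $i$. For irreducible aperiodic $A$, the Perron--Frobenius eigenvalue is $\lambda=\lim_{n\to\infty}(a^{(n)}_{ii})^{1/n}$ (independent of $i$), assumed to be finite; $A$ is transient if $\sum_n a^{(n)}_{ij}\lambda^{-n}<\infty$, and recurrent otherwise. For irreducible, aperiodic, recurrent $A$ (with $\lambda<\infty$), the generalized Perron--Frobenius theorem gives a strictly positive right eigenvector $t$ with $At=\lambda t$, unique up to a constant multiple. *)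

(* Defs.v *)
From HB Require Import structures.
From mathcomp Require Import all_boot all_order all_algebra.
From mathcomp Require Import finmap.
From mathcomp Require Import all_classical all_reals all_analysis.
Set Implicit Arguments.
Unset Strict Implicit.
Unset Printing Implicit Defensive.
Import Order.TTheory GRing.Theory Num.Theory.
Local Open Scope classical_set_scope.
Local Open Scope ring_scope.

(** Countable non-negative matrices. Entries of powers are computed in [\bar R],
    so that they are defined even when a sum over [V] diverges. *)

Section CountableMatrices.
Context {R : realType} {V : countType}.
Implicit Types (A : V -> V -> R) (lambda : R) (t : V -> R).

Definition real_matrix (F : V -> V -> nat) : V -> V -> R :=
  fun v w => (F v w)%:R.

Definition transpose A : V -> V -> R := fun i j => A j i.

Fixpoint mxpow A (n : nat) (i j : V) : \bar R :=
  if n is m.+1 then (\esum_(k in [set: V]) ((A i k)%:E * mxpow A m k j))%E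
  else ((i == j)%:R)%:E.

Definition irreducible A : Prop :=
  forall i j, exists n, (0 < mxpow A n i j)%E.

(* The gcd of the set of return times is 1: every common divisor is 1. The
   return time 0 divides out (every d divides 0). *)
Definition aperiodic A : Prop :=
  forall i (d : nat),
    (forall l : nat, (0 < mxpow A l i i)%E -> (d %| l)%N) -> d = 1%N.

(* Taking [lambda : R] (rather than in [\bar R]) encodes its finiteness. *)
Definition PF_eigenvalue A lambda : Prop :=
  forall i, poweR (mxpow A n i i) n%:R^-1 @[n --> \oo] --> lambda%:E.

Definition transient A lambda : Prop :=
  forall i j,
    (\sum_(0 <= n <oo) (mxpow A n i j * (lambda ^- n)%:E) < +oo)%E.

Definition recurrent A lambda : Prop := ~ transient A lambda.

Definition PF_right_eigenvector A lambda t : Prop :=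
  (forall v, 0 < t v) /\
  forall i, (\esum_(j in [set: V]) (A i j * t j)%:E = (lambda * t i)%:E)%E.

End CountableMatrices.

(** Generalized Bratteli diagrams. All levels [V_n] are identified with [V];
    [edge n] is the set [E_n] of edges between levels [n] and [n+1]. *)

Record graded_graph (V : countType) := GradedGraph {
  edge : nat -> choiceType;
  src : forall n, edge n -> V;
  rng : forall n, edge n -> V }.
Arguments src {V g n}.
Arguments rng {V g n}.

Section Incidence.
Context {V : countType} (G : graded_graph V).

Definition edges_between (n : nat) (w v : V) : set (edge G n) :=
  [set e | src e = w /\ rng e = v].
Arguments edges_between : clear implicits.

Definition incidence (n : nat) (v w : V) : nat :=
  #|` fset_set (edges_between n w v)|.

End Incidence.
Arguments edges_between {V} G n w v.

Record bratteli (V : countType) := Bratteli {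
  bratteli_graph :> graded_graph V;
  vertices_infinite : infinite_set [set: V];
  finite_edges : forall n w v, finite_set (edges_between bratteli_graph n w v);
  finite_rows : forall n v,
    finite_set [set w | incidence bratteli_graph n v w != 0%N];
  no_zero_row : forall n v, exists w, incidence bratteli_graph n v w != 0%N;
  no_zero_column : forall n w, exists v, incidence bratteli_graph n v w != 0%N }.

Definition stationary (V : countType) (B : bratteli V) (F : V -> V -> nat) :
  Prop := forall n v w, incidence B n v w = F v w.

Section PathSpace.
Context {V : countType} (B : bratteli V).

Record inf_path := InfPath {
  path_edge :> forall n, edge B n;
  path_adj : forall n, rng (path_edge n) = src (path_edge n.+1) }.

(* The finite path (e_0, ..., e_n), starting in V_0 and ending in V_{n+1}. *)
Record fin_path (n : nat) := FinPath {
  fpath_edge :> forall i : 'I_n.+1, edge B i;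
  fpath_adj : forall (i : nat) (hi : (i.+1 < n.+1)%N),
    rng (fpath_edge (Ordinal (ltnW hi))) = src (fpath_edge (Ordinal hi)) }.

Definition terminal n (e : fin_path n) : V := rng (e ord_max).

Definition cylinder n (e : fin_path n) : set inf_path :=
  [set x : inf_path | forall i : 'I_n.+1, x i = e i].

Definition cylinders : set (set inf_path) :=
  [set C | exists n (e : fin_path n), C = cylinder e].

Lemma out_edge n w : exists e : edge B n, src e = w.
Proof.
have [v] := no_zero_column B n w.
rewrite /incidence cardfs_eq0 => /fset0Pn[e].
by rewrite in_fset_set ?inE; [case; exists e|exact: finite_edges].
Qed.

Lemma inf_path_exists : exists _ : inf_path, True.
Proof.
have [w0 _] := infinite_setN0 (vertices_infinite B).
pose out n w : edge B n := sval (cid (out_edge n w)).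
have outE n w : src (out n w) = w by rewrite /out; case: cid.
pose walk := fix walk n : edge B n :=
  if n is m.+1 then out m.+1 (rng (walk m)) else out 0%N w0.
by unshelve eexists (@InfPath walk _) => // n; rewrite outE.
Qed.

HB.instance Definition _ := gen_eqMixin inf_path.
HB.instance Definition _ := gen_choiceMixin inf_path.
(* Measurable types of the library are pointed. *)
HB.instance Definition _ := isPointed.Build inf_path (sval (cid inf_path_exists)).

Definition truncate (x : inf_path) n : fin_path n :=
  @FinPath n (fun i => x i) (fun i _ => path_adj x i).

Lemma cylinders_cover : \bigcup_(C in cylinders) C = [set: inf_path].
Proof.
apply/seteqP; split=> // x _.
by exists (cylinder (truncate x 0)) => //; exists 0%N, (truncate x 0).
Qed.

Lemma cylinders_join (C D : set inf_path) (x : inf_path) :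
  cylinders C -> cylinders D -> C x -> D x ->
  exists K, [/\ cylinders K, K x & K `<=` C `&` D].
Proof.
move=> [n [e ->]] [m [f ->]] xe xf.
exists (cylinder (truncate x (maxn n m))); split=> [|//|y yx].
  by exists (maxn n m), (truncate x (maxn n m)).
have yxE k : (k < (maxn n m).+1)%N -> y k = x k.
  by move=> km; exact: (yx (Ordinal km)).
split=> i; rewrite yxE ?xe ?xf// (leq_trans (ltn_ord i))// ltnS.
  exact: leq_maxl.
exact: leq_maxr.
Qed.

HB.instance Definition _ := isBaseTopological.Build inf_path
  cylinders_cover cylinders_join.

End PathSpace.

Notation borel_path B := (g_sigma_algebraType (@open (inf_path B))).

Section Measures.
Context {R : realType} {V : countType} {B : bratteli V}.
Implicit Type mu : {measure set (borel_path B) -> \bar R}.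

Definition tail_invariant mu : Prop :=
  forall n (e e' : fin_path B n), terminal e = terminal e' ->
    mu (cylinder e) = mu (cylinder e').

(* The measure attached to [t]: a finite path ending at v in V_m has m edges,
   and its cylinder set has measure t_v / lambda^m. *)
Definition PF_measure (lambda : R) (t : V -> R) mu : Prop :=
  forall n (e : fin_path B n),
    mu (cylinder e) = (t (terminal e) / lambda ^+ n.+1)%:E.

End Measures.

(* Main.v *)
(** Put P = F / lambda and let P act on functions u >= 0 by
    (u P)_w = \sum_v u_v P_vw, so that t is an eigenvector of F^T iff t P = t.
    If t is excessive (t P <= t), the defect d = t - t P satisfies
    \sum_n d P^n <= t, which is incompatible with recurrence unless d = 0, that
    is, unless t is harmonic.  Hence, for two positive harmonic t and t', the
    excessive function min (t, c t') is harmonic, and so is t - min (t, c t') >= 0;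
    choosing c so that it vanishes at one vertex makes it vanish everywhere, so
    t <= c t'.  A harmonic function is obtained from the Green functions
    \sum_n s^n (P^n)_ov, finite for s < 1 by the root test: normalized at o they
    satisfy s (u P) <= u, and their lower limit as s -> 1 is excessive.

    The measure is the image of Lebesgue measure on [0, \sum_v t_v[: by the relation
    \sum_(src e = v) t_(rng e) / lambda^(n+1) = t_v / lambda^n this interval can
    be cut successively, one piece of the prescribed length for each finite path,
    and every real number in it then follows a unique infinite path. *)

Require Import Defs.
From HB Require Import structures.
From mathcomp Require Import all_boot all_order all_algebra.
From mathcomp Require Import finmap.
From mathcomp Require Import all_classical all_reals all_analysis.
From mathcomp Require Import ring lra.
Set Implicit Arguments.
Unset Strict Implicit.
Unset Printing Implicit Defensive.
Import Order.TTheory GRing.Theory Num.Theory.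
Import numFieldNormedType.Exports.
Local Open Scope classical_set_scope.
Local Open Scope ring_scope.

(** * Sums over countable sets *)

Section Esum.
Context {R : realType}.
Implicit Types T I J : choiceType.
Local Open Scope ereal_scope.

Lemma esumZl T (D : set T) (a : T -> \bar R) (c : R) :
  (0 <= c)%R -> (forall i, 0 <= a i) ->
  \esum_(i in D) (c%:E * a i) = c%:E * \esum_(i in D) a i.
Proof.
move=> c0 a0; rewrite /esum -ereal_supZl//; last first.
  by apply/set0P; exists 0; exists set0; [exact: fsets_set0|rewrite fsbig_set0].
congr ereal_sup; apply/seteqP; split=> [_ [X DX <-]|_ [_ [X DX <-] <-]] /=.
  by exists (\sum_(i \in X) a i); [exists X|rewrite ge0_mule_fsumr].
by exists X => //; rewrite ge0_mule_fsumr.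
Qed.

Lemma esum_exchange I J (D : set I) (E : set J) (a : I -> J -> \bar R) :
  (forall i j, 0 <= a i j) ->
  \esum_(i in D) \esum_(j in E) a i j = \esum_(j in E) \esum_(i in D) a i j.
Proof.
move=> a0; rewrite !esum_esum//.
rewrite (reindex_esum (E `*`` (fun=> D)) (D `*`` (fun=> E))
  (fun k => (k.2, k.1)))//.
split=> [[i j] []//|[i j] [i' j'] _ _ [-> ->]//|[i j] [/= Di Ej]].
by exists (j, i).
Qed.

Lemma le_esum_term T (D : set T) (a : T -> \bar R) i :
  D i -> a i <= \esum_(j in D) a j.
Proof.
move=> Di; apply: esum_ge; exists [set i]; last by rewrite fsbig_set1.
by split=> // _ ->.
Qed.

Lemma esum_single T (a : T -> \bar R) i :
  0 <= a i -> (forall j, j != i -> a j = 0) -> \esum_(j in [set: T]) a j = a i.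
Proof.
move=> ai0 a0; have age0 j : 0 <= a j.
  by have [->//|/a0->] := eqVneq j i.
rewrite (esumID [set i])// setTI esum_set1// setTI esum1 ?adde0// => j /eqP.
exact: a0.
Qed.

Lemma esum_lty T (D : set T) (a : T -> \bar R) :
  finite_set [set i | a i != 0] -> (forall i, 0 <= a i) ->
  (forall i, a i < +oo) -> \esum_(i in D) a i < +oo.
Proof.
move=> fa a0 aoo.
rewrite (esumID [set i | a i != 0])// [X in _ + X]esum1 ?adde0; last first.
  by move=> i [_ /negP]; rewrite negbK => /eqP.
have fD : finite_set (D `&` [set i | a i != 0]) by exact: finite_setIr.
by rewrite esum_fset// fsbig_finite//=; exact: lte_sum_pinfty.
Qed.

End Esum.

(** * Excessive and harmonic functions of a recurrent matrix *)

Section Push.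
Context {R : realType} {V : countType} (A : V -> V -> R).
Hypothesis A_ge0 : forall i j, (0 <= A i j)%R.
Local Open Scope ereal_scope.
Implicit Types u : V -> \bar R.

Let AE_ge0 i j : 0 <= (A i j)%:E. Proof. by rewrite lee_fin. Qed.
Local Hint Resolve A_ge0 AE_ge0 : core.

Lemma mxpow_ge0 n i j : 0 <= mxpow A n i j.
Proof.
elim: n i => [i|n IH i] /=; first by rewrite lee_fin ler0n.
by apply: esum_ge0 => k _; rewrite mule_ge0.
Qed.
Local Hint Resolve mxpow_ge0 : core.

(** [mxpow] unfolds its first factor, whereas functions are multiplied by the matrix on their right,
    which calls for unfolding the last one. *)
Lemma mxpowSr n i j :
  mxpow A n.+1 i j = \esum_(k in [set: V]) ((A k j)%:E * mxpow A n i k).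
Proof.
elim: n i => [i|n IH i].
  rewrite /= (esum_single (i := j)) ?(esum_single (i := i)).
  - by rewrite !eqxx.
  - by rewrite eqxx mule1.
  - by move=> k; rewrite eq_sym => /negPf->; rewrite mule0.
  - by rewrite eqxx mule1.
  - by move=> k /negPf->; rewrite mule0.
transitivity (\esum_(k in [set: V]) \esum_(l in [set: V])
    ((A i k)%:E * ((A l j)%:E * mxpow A n k l))).
  apply: eq_esum => k _; rewrite esumZl// => [|l]; last by rewrite mule_ge0.
  by rewrite -IH.
rewrite esum_exchange => [|k l]; last by rewrite !mule_ge0.
apply: eq_esum => l _; rewrite -esumZl// => [|k]; last by rewrite mule_ge0.
by apply: eq_esum => k _; rewrite muleCA.
Qed.

Definition push u : V -> \bar R :=
  fun j => \esum_(i in [set: V]) ((A i j)%:E * u i).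

Lemma push_ge0 u : (forall i, 0 <= u i) -> forall j, 0 <= push u j.
Proof. by move=> u0 j; apply: esum_ge0 => i _; rewrite mule_ge0. Qed.

Lemma le_push u u' : (forall i, u i <= u' i) -> forall j, push u j <= push u' j.
Proof. by move=> uu' j; apply: le_esum => i _; rewrite lee_wpmul2l. Qed.

Lemma pushD u u' : (forall i, 0 <= u i) -> (forall i, 0 <= u' i) ->
  forall j, push (fun i => u i + u' i) j = push u j + push u' j.
Proof.
move=> u0 u'0 j; rewrite -esumD; do ?by move=> i _; rewrite mule_ge0.
by apply: eq_esum => i _; rewrite ge0_muleDr.
Qed.

Lemma pushZ (c : R) u : (0 <= c)%R -> (forall i, 0 <= u i) ->
  forall j, push (fun i => c%:E * u i) j = c%:E * push u j.
Proof.
move=> c0 u0 j; rewrite -esumZl// => [|i]; last by rewrite mule_ge0.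
by apply: eq_esum => i _; rewrite muleCA.
Qed.

Lemma iter_push_ge0 n u : (forall i, 0 <= u i) ->
  forall j, 0 <= iter n push u j.
Proof. by move=> u0; elim: n => //= n IH j; exact: push_ge0. Qed.

Lemma eq_push u u' : u =1 u' -> push u =1 push u'.
Proof. by move=> uu' j; apply: eq_esum => i _; rewrite uu'. Qed.

Lemma eq_iter_push n u u' : u =1 u' -> iter n push u =1 iter n push u'.
Proof. by move=> uu'; elim: n => //= n IH; exact: eq_push. Qed.

Lemma iter_pushD n u u' : (forall i, 0 <= u i) -> (forall i, 0 <= u' i) ->
  forall j, iter n push (fun i => u i + u' i) j =
    iter n push u j + iter n push u' j.
Proof.
move=> u0 u'0; elim: n => //= n IH j.
by rewrite (eq_push IH) pushD// => i; exact: iter_push_ge0.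
Qed.

(** Only the mass [c] sitting at [i] is followed along the paths of length [n] to [j]. This is how
    irreducibility acts on functions below. *)
Lemma iter_push_ge n u i j (c : R) : (forall i, 0 <= u i) ->
  (0 <= c)%R -> c%:E <= u i -> c%:E * mxpow A n i j <= iter n push u j.
Proof.
move=> u0 c0 cu; elim: n j => [j|n IH j].
  rewrite /=; have [<-|ij] := eqVneq i j; first by rewrite mule1.
  by rewrite mule0.
rewrite mxpowSr -esumZl// => [|k]; last by rewrite mule_ge0.
apply: le_esum => k _; rewrite muleCA lee_wpmul2l//.
Qed.

End Push.

Section Recurrence.
Context {R : realType} {V : countType} (A : V -> V -> R).
Hypothesis A_ge0 : forall i j, (0 <= A i j)%R.
Hypothesis A_irr : irreducible A.
Hypothesis A_rec : ~ forall i j, (\sum_(0 <= n <oo) mxpow A n i j < +oo)%E.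
Local Open Scope ereal_scope.

Lemma sum_iter_push_defect (t d : V -> \bar R) :
  (forall j, 0 <= t j) -> (forall j, 0 <= d j) ->
  (forall j, t j = push A t j + d j) -> forall N j,
  \sum_(n < N) iter n (push A) d j + iter N (push A) t j = t j.
Proof.
move=> t0 d0 tE; elim=> [|N IH] j; first by rewrite big_ord0 add0e.
rewrite big_ord_recr/= -[RHS](IH j) -addeA; congr (_ + _).
rewrite [RHS](eq_iter_push A N tE) iter_pushD//; last exact: push_ge0.
by rewrite addeC -iterSr.
Qed.

(** A defect d positive at [v] reaches [i] after some [m] steps: e = d A^m has e_i > 0. Then e_i
    \sum_n (A^n)_ij <= \sum_n (d A^(n+m))_j <= t_j bounds every Green function, against [A_rec]. *)
Lemma excessive_harmonic (t : V -> R) : (forall j, 0 <= t j)%R ->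
  (forall j, push A (EFin \o t) j <= (t j)%:E) ->
  forall j, push A (EFin \o t) j = (t j)%:E.
Proof.
move=> t0 tA v; apply/eqP; rewrite eq_le tA/= leNgt; apply/negP => tv.
apply: A_rec => i j.
have P0 k : 0 <= push A (EFin \o t) k.
  by apply: push_ge0 => // l; rewrite lee_fin.
have Pfin k : push A (EFin \o t) k \is a fin_num.
  by rewrite ge0_fin_numE// (le_lt_trans (tA k))// ltry.
(* The partial sums of d, push A d, ... telescope to at most t. *)
pose d k := (t k)%:E - push A (EFin \o t) k.
have d0 k : 0 <= d k by rewrite sube_ge0 ?Pfin.
have dsum N k : \sum_(n < N) iter n (push A) d k <= (t k)%:E.
  rewrite -[leRHS](@sum_iter_push_defect (EFin \o t) d _ d0 _ N) => [|l|l].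
  - by rewrite leeDl// iter_push_ge0// => l; rewrite lee_fin.
  - by rewrite lee_fin.
  - by rewrite addeC subeK.
have [m mvi] := A_irr v i.
pose e := iter m (push A) d.
have e0 k : 0 <= e k by exact: iter_push_ge0.
have efin : e i \is a fin_num.
  rewrite ge0_fin_numE// (@le_lt_trans _ _ (t i)%:E) ?ltry//.
  apply: le_trans (dsum m.+1 i); rewrite big_ord_recr/= leeDr//.
  by apply: sume_ge0 => n _; exact: iter_push_ge0.
have dv : d v \is a fin_num by rewrite fin_numB Pfin.
have ei : 0 < e i.
  apply: (@lt_le_trans _ _ (d v * mxpow A m v i)).
    by rewrite mule_gt0// sube_gt0.
  rewrite -[d v]fineK//; apply: iter_push_ge => //; first exact: fine_ge0.
  by rewrite fineK.
have c0 : (0 < fine (e i))%R by rewrite fine_gt0// ei ltey_eq efin.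
suff le N : \sum_(0 <= n < N) mxpow A n i j <= (t j / fine (e i))%:E.
  apply: (@le_lt_trans _ _ (t j / fine (e i))%:E); last exact: ltry.
  apply: lime_le; last exact: nearW.
  by apply: is_cvg_nneseries => n _ _; exact: mxpow_ge0.
rewrite EFinM lee_pdivlMr// muleC ge0_sume_distrr; last first.
  by move=> n _; exact: mxpow_ge0.
apply: le_trans (dsum (N + m)%N j).
rewrite big_mkord addnC -(big_mkord xpredT (fun n => iter n (push A) d j)).
rewrite (@big_cat_nat _ _ _ m)//= ?leq_addr//.
apply: le_trans (leeDr _ _); last first.
  by apply: sume_ge0 => n _; exact: iter_push_ge0.
rewrite -[X in (\sum_(X <= _ < _) _)%R]add0n big_addn addKn !big_mkord.
apply: lee_sum => n _.
rewrite iterD; apply: iter_push_ge => //; first exact: ltW.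
by rewrite fineK.
Qed.

Lemma harmonic_dominated (t t' : V -> R) :
  (forall j, 0 < t j)%R -> (forall j, 0 < t' j)%R ->
  (forall j, push A (EFin \o t) j = (t j)%:E) ->
  (forall j, push A (EFin \o t') j = (t' j)%:E) ->
  forall o j, (t j <= t o / t' o * t' j)%R.
Proof.
move=> t0 t'0 tA t'A o; set c := (t o / t' o)%R.
have c0 : (0 < c)%R by rewrite divr_gt0.
pose m j := Num.min (t j) (c * t' j)%R.
have m0 j : (0 <= m j)%R by rewrite le_min !ltW// mulr_gt0.
have mA : forall j, push A (EFin \o m) j = (m j)%:E.
  apply: excessive_harmonic => // j; rewrite EFin_min le_min; apply/andP; split.
    by rewrite -tA; apply: le_push => // i; rewrite lee_fin ge_min lexx.
  rewrite EFinM -t'A -pushZ//; [|exact: ltW|by move=> i; rewrite lee_fin ltW].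
  by apply: le_push => // i; rewrite -EFinM lee_fin ge_min lexx orbT.
pose u j := (t j - m j)%R.
have u0 j : (0 <= u j)%R by rewrite subr_ge0 ge_min lexx.
have uA j : push A (EFin \o u) j = (u j)%:E.
  rewrite EFinB -tA -mA.
  rewrite -[X in _ = push A X _ - _](_ : (fun i => (u i)%:E + (m i)%:E) = _).
    by rewrite pushD// mA addeK.
  by apply/funext => i; rewrite -EFinD subrK.
have uAn n j : iter n (push A) (EFin \o u) j = (u j)%:E.
  elim: n j => //= n IH j; rewrite -[RHS]uA; exact: eq_push.
(* [c] is chosen for this: at [o] both arguments of the minimum equal [t o]. *)
have uo : u o = 0%R by rewrite /u /m /c divfK ?gt_eqF// minxx subrr.
move=> j; suff uj0 : u j = 0%R.
  by move/eqP: uj0; rewrite subr_eq0 => /eqP->; rewrite ge_min lexx orbT.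
have [n nj] := A_irr j o.
(* Harmonicity carries u_j to [o]: u_j (A^n)_jo <= u_o = 0, with (A^n)_jo > 0. *)
have : (u j)%:E * mxpow A n j o <= 0.
  rewrite -[leRHS]/(0%R%:E) -uo -(uAn n o); apply: iter_push_ge => //.
apply: contraPP => /eqP uj; apply/negP; rewrite -ltNge mule_gt0// lte_fin.
by rewrite lt_neqAle eq_sym uj u0.
Qed.

End Recurrence.

(** * Existence of a positive excessive function *)

Section ExcessiveExistence.
Context {R : realType} {V : countType} (A : V -> V -> R).
Hypothesis A_ge0 : forall i j, (0 <= A i j)%R.
Hypothesis A_irr : irreducible A.
Local Open Scope ereal_scope.

(** [g] is the Green function started at [o], divided by its value at [o]. Values other than [g o]
    may still be infinite here. *)
Lemma discounted_excessive (o : V) (s : R) : (0 < s)%R ->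
  \sum_(0 <= n <oo) ((s ^+ n)%:E * mxpow A n o o) < +oo ->
  exists g : V -> \bar R, [/\ forall i, 0 <= g i, g o = 1 &
    forall i, s%:E * push A g i <= g i].
Proof.
move=> s0 Goo.
pose b v n := (s ^+ n)%:E * mxpow A n o v.
have b0 v n : 0 <= b v n.
  by rewrite mule_ge0 ?mxpow_ge0// lee_fin exprn_ge0// ltW.
pose G v := \esum_(n in [set: nat]) b v n.
have G0 v : 0 <= G v by apply: esum_ge0.
have GA v : s%:E * push A G v <= G v.
  (* One more discounted step shifts the Green series by one index, so only its term of index 0 is
     lost. *)
  rewrite [leLHS](_ : _ = \esum_(n in [set: nat]) b v n.+1).
    rewrite -(esum_image [set: nat] succn (b v)); last by move=> m n _ _ [].
    rewrite /G [leRHS](esumID (range succn))// setTI leeDl//.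
    exact: esum_ge0.
  rewrite -esumZl//; [|exact: ltW|by move=> i; rewrite mule_ge0// lee_fin].
  transitivity (\esum_(i in [set: V]) \esum_(n in [set: nat])
      ((s ^+ n.+1)%:E * ((A i v)%:E * mxpow A n o i))).
    apply: eq_esum => i _; rewrite -esumZl//.
    rewrite -esumZl//; [|exact: ltW|by move=> n; rewrite mule_ge0// lee_fin].
    apply: eq_esum => n _.
    by rewrite /b exprS EFinM -muleA; congr (_ * _); rewrite muleCA.
  have mA0 i n : 0 <= (A i v)%:E * mxpow A n o i.
    by rewrite mule_ge0 ?mxpow_ge0// lee_fin.
  have sn0 n : (0 <= s ^+ n)%R by rewrite exprn_ge0// ltW.
  rewrite esum_exchange => [|i n]; last by rewrite mule_ge0// lee_fin.
  by apply: eq_esum => n _; rewrite esumZl// /b mxpowSr.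
have Gofin : G o \is a fin_num.
  by rewrite ge0_fin_numE// /G -nneseries_esumT//.
have Go : (0 < fine (G o))%R.
  rewrite -lte_fin fineK// (@lt_le_trans _ _ 1)//.
  rewrite (le_trans _ (@le_esum_term _ _ _ _ 0%N _))// /b /= eqxx.
  by rewrite expr0 mule1.
exists (fun v => (fine (G o))^-1%:E * G v); split=> [v||v].
- by rewrite mule_ge0// lee_fin invr_ge0 ltW.
- by rewrite -[X in _ * X]fineK// -EFinM mulVf// gt_eqF.
- have Go_inv : (0 <= (fine (G o))^-1)%R by rewrite invr_ge0 ltW.
  by rewrite pushZ// muleCA lee_wpmul2l.
Qed.

Lemma excessive_limit (o : V) (s : nat -> R) (g : nat -> V -> \bar R) :
  {homo s : m n / (m <= n)%N >-> (m <= n)%R} -> (forall n, 0 < s n)%R ->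
  s n @[n --> \oo] --> (1%R : R) ->
  (forall n i, 0 <= g n i) -> (forall n, g n o = 1) ->
  (forall n i, (s n)%:E * push A (g n) i <= g n i) ->
  exists t : V -> \bar R, [/\ forall i, 0 <= t i, t o = 1 &
    forall i, push A t i <= t i].
Proof.
move=> s_homo s0 s1 g0 go gA.
(* The condition [s * push A u <= u] is stable under infima of such [u]. *)
pose m n i := einfs (fun k => g k i) n.
have m0 n i : 0 <= m n i.
  by apply: le_ereal_inf_tmp => _ [k _ <-].
have mA n i : (s n)%:E * push A (m n) i <= m n i.
  apply: le_ereal_inf_tmp => _ [k nk <-].
  apply: le_trans (gA k i); apply: lee_pmul => //.
  - by rewrite lee_fin ltW.
  - exact: push_ge0.
  - by rewrite lee_fin s_homo.
  - by apply: le_push => // j; apply: ereal_inf_lbound; exists k.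
(* [t] is the lower limit of the [g n], to which the tail infima [m n] increase. *)
pose t i := ereal_sup (range (fun n => m n i)).
have m_le n i : m n i <= t i by apply: ereal_sup_ubound; exists n.
have m_cvg i : m n i @[n --> \oo] --> t i by exact: cvg_einfs_sup.
exists t; split=> [i||i].
- exact: le_trans (m0 0%N i) (m_le _ _).
- rewrite /t (_ : range _ = [set 1]) ?ereal_sup1//.
  have mo n : m n o = 1.
    rewrite /m /einfs /= (_ : sdrop _ _ = [set 1]) ?ereal_inf1//.
    by apply/seteqP; split=> [_ [k _ <-]|_ ->] /=; [exact: go|exists n => /=].
  apply/seteqP; split=> [_ [k _ <-]|_ ->] /=; first exact: mo.
  by exists 0%N => //; exact: mo.
(* Fatou's argument: the sum over [V] is the supremum of its finite subsums, and each of these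
   passes to the limit in [n]. *)
apply: ge_ereal_sup => _ [X [finX _] <-].
pose S n := \sum_(j \in X) ((A j i)%:E * m n j).
have S_cvg : (s n)%:E * S n @[n --> \oo]
    --> 1 * \sum_(j \in X) ((A j i)%:E * t j).
  apply: cvgeM; first by rewrite mule_defE onee_eq0/= andbF.
    by apply: cvg_EFin => //; exact: nearW.
  rewrite /S; under eq_fun do rewrite fsbig_finite//=.
  rewrite fsbig_finite//=; apply: cvg_nnesum => j _.
    by apply: nearW => n; rewrite mule_ge0// lee_fin.
  exact: cvgeZl.
rewrite mul1e in S_cvg; rewrite -(cvg_lim _ S_cvg)//.
apply: lime_le; first by apply/cvg_ex; eexists; exact: S_cvg.
apply: nearW => n; apply: le_trans (m_le n i); apply: le_trans (mA n i).
rewrite lee_wpmul2l ?lee_fin//; first exact: ltW.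
by apply: esum_ge; exists X.
Qed.

(** Paths to [o] bound t_i above, since t_i (A^n)_io <= t_o = 1; paths from [o] bound it below,
    since (A^n)_oi <= t_i. *)
Lemma excessive_real (o : V) (t : V -> \bar R) : (forall i, 0 <= t i) ->
  t o = 1 -> (forall i, push A t i <= t i) ->
  exists2 t' : V -> R, forall i, (0 < t' i)%R & forall i, t i = (t' i)%:E.
Proof.
move=> t0 to tA.
have tAn n i : iter n (push A) t i <= t i.
  elim: n i => //= n IH i; apply: le_trans (tA i); exact: le_push.
have tfin i : t i \is a fin_num.
  rewrite ge0_fin_numE// ltey; apply/negP => /eqP tioo.
  have [n nio] := A_irr i o.
  have [e e0 en] : exists2 e : R, (0 < e)%R & e%:E <= mxpow A n i o.
    case: (mxpow A n i o) nio => [r|_|//]; last by exists 1%R; rewrite ?leey.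
    by rewrite lte_fin => r0; exists r.
  have := tAn n o; apply/negP; rewrite -ltNge to.
  (* If [t i] is infinite, every real constant lies below it; 2 / e gives [t o] >= 2, contradicting
     [t o] = 1. *)
  have c0 : (0 <= 2 / e)%R by rewrite divr_ge0// ltW.
  apply: (@lt_le_trans _ _ ((2 / e)%:E * mxpow A n i o)).
    apply: (@lt_le_trans _ _ ((2 / e)%:E * e%:E)); last by rewrite lee_wpmul2l.
    by rewrite -EFinM divfK ?gt_eqF// lte_fin ltr1n.
  by apply: iter_push_ge => //; rewrite tioo leey.
exists (fine \o t) => [i|i]; last by rewrite /= fineK.
rewrite -lte_fin /= fineK//; have [n noi] := A_irr o i.
apply: lt_le_trans (tAn n i); rewrite (lt_le_trans noi)//.
by rewrite -[leLHS]mul1e; apply: iter_push_ge => //; rewrite to.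
Qed.

End ExcessiveExistence.

(** * The root test for series of extended reals *)

Section RootTest.
Context {R : realType}.
Local Open Scope ereal_scope.

Lemma root_test (a : nat -> \bar R) (l q : R) :
  (forall n, 0 <= a n) -> (forall n, a n < +oo) -> (0 < l)%R ->
  (0 < q < 1)%R -> poweR (a n) n%:R^-1 @[n --> \oo] --> l%:E ->
  \sum_(0 <= n <oo) (((q / l) ^+ n)%:E * a n) < +oo.
Proof.
move=> a0 aoo l0 /andP[q0 q1] al.
(* [r] lies strictly between [q] and 1, so [c] = l r / q exceeds [l]. Eventually a_n <= c^n, and the
   terms of the series are at most r^n. *)
pose r := ((1 + q) / 2)%R.
have qr : (q < r)%R by rewrite /r; lra.
have r1 : (r < 1)%R by rewrite /r; lra.
have r0 : (0 < r)%R by exact: lt_trans qr.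
pose c := (l * (r / q))%R.
have lc : l%:E < c%:E.
  by rewrite lte_fin /c ltr_pMr// ltr_pdivlMr// mul1r.
have c0 : (0 <= c)%R by rewrite -lee_fin (le_trans _ (ltW lc))// lee_fin ltW.
have afin n : a n = (fine (a n))%:E by rewrite fineK// ge0_fin_numE.
have [N _ aN] : \forall n \near \oo, poweR (a n) n%:R^-1 < c%:E.
  apply: (al [set x | x < c%:E]); apply: open_nbhs_nbhs; split=> //.
  exact: open_ereal_lt_ereal.
have b0 n : 0 <= ((q / l) ^+ n)%:E * a n.
  by rewrite mule_ge0// lee_fin exprn_ge0// divr_ge0// ltW.
(* Starting at [N.+1] rather than [N] excludes n = 0, where the exponent 1/n is 0 by convention. *)
have bN n : (N.+1 <= n)%N -> ((q / l) ^+ n)%:E * a n <= (r ^+ n)%:E.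
  move=> Nn; have n0 : (0 < n)%N by exact: leq_trans Nn.
  have := aN n (ltnW Nn); rewrite /= afin poweR_EFin lte_fin => /ltW anc.
  rewrite -EFinM lee_fin.
  have -> : r = (q / l * c)%R.
    by rewrite /c; field; rewrite !gt_eqF.
  rewrite [leRHS]exprMn ler_wpM2l//.
    by rewrite exprn_ge0// divr_ge0// ltW.
  have fa0 : (0 <= fine (a n))%R by exact: fine_ge0.
  rewrite -[leLHS](powRr1 fa0) -(@mulVf _ n%:R) ?pnatr_eq0 -?lt0n//.
  by rewrite powRrM powR_mulrn ?powR_ge0// lerXn2r// nnegrE powR_ge0.
rewrite (nneseries_split 0%N N.+1)// add0n.
apply: lte_add_pinfty.
  by apply: lte_sum_pinfty => n _; rewrite afin -EFinM ltry.
apply: (@le_lt_trans _ _ (1 / (1 - r))%:E); last exact: ltry.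
apply: lime_le; first by apply: is_cvg_nneseries.
apply: nearW => n.
apply: (@le_trans _ _ (\sum_(0 <= i < n) (r ^+ i)%:E)); last first.
  rewrite sumEFin lee_fin.
  have := @geometric_le_lim R n 1 r ler01 r0.
  rewrite gtr0_norm// => /(_ r1); apply: le_trans.
  by rewrite /series/=; apply: ler_sum => i _; rewrite mul1r.
apply: (@le_trans _ _ (\sum_(N.+1 <= i < n) (r ^+ i)%:E)).
  rewrite big_nat_cond [leRHS]big_nat_cond; apply: lee_sum.
  by move=> i /andP[/andP[Ni _] _]; exact: bN.
have [nN|Nn] := leqP n N.+1.
  rewrite big_geq// sume_ge0// => i _.
  by rewrite lee_fin exprn_ge0// ltW.
rewrite [leRHS](big_cat_nat _ (ltnW Nn)) => [|//].
rewrite leeDr// sume_ge0// => i _.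
by rewrite lee_fin exprn_ge0// ltW.
Qed.

End RootTest.

(** * Eigenvectors through the normalized matrix P = A / lambda *)

Section PerronFrobenius.
Context {R : realType} {V : countType} (A : V -> V -> R) (lambda : R).
Hypothesis A_ge0 : forall i j, (0 <= A i j)%R.
Local Open Scope ereal_scope.

Lemma mxpowZ (c : R) n i j : (0 <= c)%R ->
  mxpow (fun i j => c * A i j)%R n i j = (c ^+ n)%:E * mxpow A n i j.
Proof.
move=> c0; elim: n i => [|n IH] i /=; first by rewrite mul1e.
rewrite -esumZl ?exprn_ge0// => [|k].
  apply: eq_esum => k _; rewrite IH exprS EFinM EFinM.
  by rewrite -!muleA; congr (_ * _); rewrite muleCA.
by rewrite mule_ge0 ?mxpow_ge0// lee_fin.
Qed.

Lemma mxpow_lty : (forall i, finite_set [set j | A i j != 0%R]) ->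
  forall n i j, mxpow A n i j < +oo.
Proof.
move=> finA; elim=> [|n IH] i j /=; first exact: ltry.
apply: esum_lty => [|k|k].
- apply: sub_finite_set (finA i) => k /=; apply: contra => /eqP->.
  by rewrite mul0e.
- by rewrite mule_ge0 ?mxpow_ge0// lee_fin.
- have := IH k j; have := mxpow_ge0 A_ge0 n k j.
  by case: (mxpow A n k j) => // r _ _; rewrite -EFinM ltry.
Qed.

Hypothesis A_irr : irreducible A.
Hypothesis A_rec : recurrent A lambda.
Hypothesis A_PF : PF_eigenvalue A lambda.

Lemma recurrent_witness : exists _ : V, True.
Proof.
apply: contrapT => V0; apply: A_rec => i.
by exfalso; apply: V0; exists i.
Qed.

Lemma PF_eigenvalue_gt0 : (0 < lambda)%R.
Proof.
have [w _] := recurrent_witness.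
rewrite lt_neqAle eq_sym; apply/andP; split.
  (* As 0 is its own inverse by convention, lambda = 0 would leave only the term of index 0 in the
     series, making the matrix transient. *)
  apply/eqP => l0; apply: A_rec => i j.
  rewrite (nneseries_split 0%N 1%N) => [|n _]; last first.
    by rewrite mule_ge0 ?mxpow_ge0// lee_fin invr_ge0 l0 exprn_ge0.
  rewrite [X in _ + X]eseries0 => [|n n1 _]; last first.
    by rewrite l0 expr0n gtn_eqF//= invr0 mule0.
  by rewrite adde0 big_nat1 expr0 invr1 mule1 /= ltry.
rewrite -lee_fin; have := A_PF w => /cvg_lim <-//.
apply: lime_ge; first by apply/cvg_ex; eexists; exact: A_PF.
by apply: nearW => n; exact: poweR_ge0.
Qed.

Let P i j := (lambda^-1 * A i j)%R.

Let P_ge0 i j : (0 <= P i j)%R.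
Proof. by rewrite mulr_ge0// invr_ge0 ltW// PF_eigenvalue_gt0. Qed.

Let mxpow_P n i j : mxpow P n i j = (lambda ^- n)%:E * mxpow A n i j.
Proof. by rewrite mxpowZ ?exprVn// invr_ge0 ltW// PF_eigenvalue_gt0. Qed.

Let P_irr : irreducible P.
Proof.
move=> i j; have [n nij] := A_irr i j; exists n.
by rewrite mxpow_P mule_gt0// lte_fin invr_gt0 exprn_gt0// PF_eigenvalue_gt0.
Qed.

Let P_rec : ~ forall i j, \sum_(0 <= n <oo) mxpow P n i j < +oo.
Proof.
move=> H; apply: A_rec => i j.
by under eq_eseriesr do rewrite muleC -mxpow_P.
Qed.

Let PF_right_eigenvectorE (t : V -> R) :
  PF_right_eigenvector (transpose A) lambda t <->
  (forall i, 0 < t i)%R /\ forall i, push P (EFin \o t) i = (t i)%:E.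
Proof.
have l0 := PF_eigenvalue_gt0.
have tPE (t_gt0 : forall i, (0 < t i)%R) i : push P (EFin \o t) i =
    (lambda^-1)%:E * \esum_(j in [set: V]) (transpose A i j * t j)%:E.
  rewrite -esumZl => [||j]; last first.
  - by rewrite lee_fin mulr_ge0 ?(ltW (t_gt0 j))//; exact: A_ge0.
  - by rewrite invr_ge0 ltW.
  by apply: eq_esum => j _; rewrite -[RHS]EFinM -[LHS]EFinM /P/= mulrA.
split=> -[t_gt0 tE]; split=> // i.
  by rewrite tPE// tE -EFinM mulKf// gt_eqF.
by rewrite EFinM -tE tPE// muleA -EFinM divff ?gt_eqF// mul1e.
Qed.

Lemma PF_right_eigenvector_dominated (t t' : V -> R) :
  PF_right_eigenvector (transpose A) lambda t ->
  PF_right_eigenvector (transpose A) lambda t' ->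
  exists2 c : R, (0 <= c)%R & forall v, (t v <= c * t' v)%R.
Proof.
move=> /PF_right_eigenvectorE[t0 tP] /PF_right_eigenvectorE[t'0 t'P].
have [w _] := recurrent_witness.
exists (t w / t' w)%R; first by rewrite divr_ge0// ltW.
by move=> v; apply: (harmonic_dominated P_ge0 P_irr P_rec).
Qed.

(** Summability is a property of [lambda] alone, shared by all eigenvectors: any of them dominates
    any other up to a constant. *)
Lemma PF_right_eigenvector_summable (t t' : V -> R) :
  PF_right_eigenvector (transpose A) lambda t ->
  PF_right_eigenvector (transpose A) lambda t' ->
  \esum_(v in [set: V]) (t v)%:E < +oo ->
  \esum_(v in [set: V]) (t' v)%:E < +oo.
Proof.
move=> tE t'E tsum.
have [c c0 t't] := PF_right_eigenvector_dominated t'E tE.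
have t0 v : 0 <= (t v)%:E by rewrite lee_fin ltW// (proj1 tE).
apply: (@le_lt_trans _ _ (c%:E * \esum_(v in [set: V]) (t v)%:E)).
  by rewrite -esumZl//; apply: le_esum => v _; rewrite -EFinM lee_fin.
have : \esum_(v in [set: V]) (t v)%:E \is a fin_num.
  by rewrite ge0_fin_numE// esum_ge0.
by move=> /fineK <-; rewrite -EFinM ltry.
Qed.

Lemma PF_right_eigenvector_exists :
  (forall i, finite_set [set j | A i j != 0%R]) ->
  exists t : V -> R, PF_right_eigenvector (transpose A) lambda t.
Proof.
move=> finA; have [w _] := recurrent_witness.
(* The shift by 2 makes the discounts start at 1/2, hence all lie strictly between 0 and 1. *)
pose s n : R := (1 - n.+2%:R^-1)%R.
have s0 n : (0 < s n)%R by rewrite subr_gt0 invf_lt1 ?ltr1n// ltr0n.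
have s_lt1 n : (s n < 1)%R by rewrite ltrBlDr ltrDl invr_gt0 ltr0n.
have s_homo : {homo s : m n / (m <= n)%N >-> (m <= n)%R}.
  by move=> m n mn; rewrite lerD2l lerN2 lef_pV2 ?posrE ?ltr0n// ler_nat !ltnS.
have s1 : s n @[n --> \oo] --> (1%R : R).
  rewrite -[X in _ --> X]subr0; apply: cvgB; first exact: cvg_cst.
  have := @cvg_harmonic R; rewrite -(cvg_shiftS (@harmonic R)).
  exact.
have gs n : exists g : V -> \bar R, [/\ forall i, 0 <= g i, g w = 1 &
    forall i, (s n)%:E * push P g i <= g i].
  apply: discounted_excessive => //.
  (* The discount s^n and the normalization lambda^-n merge into (s / lambda)^n, the form of
     [root_test]. *)
  under eq_eseriesr do rewrite mxpow_P muleA -EFinM -exprVn -exprMn.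
  apply: root_test; rewrite ?s0 ?s_lt1//.
  - by move=> k; exact: mxpow_ge0.
  - by move=> k; exact: mxpow_lty.
  - exact: PF_eigenvalue_gt0.
have [g gP] := choice gs.
have [t [t0 to tP]] : exists t : V -> \bar R,
    [/\ forall i, 0 <= t i, t w = 1 & forall i, push P t i <= t i].
  by apply: (@excessive_limit _ _ _ P_ge0 w s g) => // n; case: (gP n).
have [t' t'0 tt'] := excessive_real P_ge0 P_irr t0 to tP.
exists t'; apply/PF_right_eigenvectorE; split=> // i.
apply: excessive_harmonic => // [j|j]; first exact: ltW.
by rewrite -tt'; apply: le_trans (tP j); apply: le_push => // k; rewrite tt'.
Qed.

End PerronFrobenius.

(** * Cutting an interval into countably many pieces *)

Section IntervalPacking.
Context {R : realType}.
Local Open Scope ereal_scope.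

Lemma sub_esum (T : choiceType) (D E : set T) (a : T -> \bar R) :
  D `<=` E -> \esum_(i in D) a i <= \esum_(i in E) a i.
Proof.
move=> DE; apply: ereal_sup_le => _ [X [finX XD] <-].
by exists X => //; split=> //; exact: subset_trans DE.
Qed.

Lemma interval_packing (T : choiceType) (D : set T) (p : T -> R) :
  countable D -> (forall i, 0 <= p i)%R ->
  exists off : T -> R, [/\
    forall i, D i -> (0 <= off i)%R /\
      (off i + p i)%:E <= \esum_(j in D) (p j)%:E,
    forall x, (0 <= x)%R -> x%:E < \esum_(j in D) (p j)%:E ->
      exists2 i, D i & (off i <= x < off i + p i)%R &
    forall x i j, D i -> D j -> (off i <= x < off i + p i)%R ->
      (off j <= x < off j + p j)%R -> i = j].
Proof.
move=> /countable_injP[f f_inj] p0.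
have pE0 i : 0 <= (p i)%:E by rewrite lee_fin.
(* The pieces are laid end to end in the order of their codes [f]; [S k] below is the length used by
   the codes smaller than [k]. *)
pose Dlt k := D `&` [set j | (f j < k)%N].
have Dlt_fin k : finite_set (Dlt k).
  have f_inj_Dlt : {in Dlt k &, injective f}.
    by move=> i j /set_mem[Di _] /set_mem[Dj _]; apply: f_inj; exact: mem_set.
  rewrite -(eq_finite_set (inj_card_eq f_inj_Dlt)).
  by apply: (sub_finite_set _ (finite_II k)) => _ [i [_ fi] <-].
have Sfin k : \esum_(j in Dlt k) (p j)%:E \is a fin_num.
  by rewrite esum_fset// fsumEFin.
pose S k := fine (\esum_(j in Dlt k) (p j)%:E).
have SE k : (S k)%:E = \esum_(j in Dlt k) (p j)%:E by rewrite fineK.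
have S0 : S 0%N = 0%R.
  by apply: EFin_inj; rewrite SE esum1// => i -[].
have S_homo : {homo S : m n / (m <= n)%N >-> (m <= n)%R}.
  move=> m n mn; rewrite -lee_fin !SE; apply: sub_esum => i [Di im].
  by split=> //; exact: leq_trans mn.
have S_succ i : D i -> S (f i).+1 = (S (f i) + p i)%R.
  move=> Di; apply: EFin_inj; rewrite EFinD !SE (esumID [set i])// addeC.
  congr (_ + _); last first.
    rewrite (_ : _ `&` _ = [set i]) ?esum_set1//.
    by apply/seteqP; split=> [j [_ ->//]|_ ->]; split=> //; split=> /=.
  congr esum; apply/seteqP; split=> j.
    move=> [[Dj]]; rewrite /= ltnS leq_eqVlt => /orP[/eqP fij|//] ji.
    by exfalso; apply: ji; apply: f_inj; rewrite ?inE.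
  move=> [Dj /= fji]; split; first by split=> //=; exact: ltnW.
  by move=> ji; rewrite ji ltnn in fji.
have S_skip k : ~ (exists2 i, D i & f i = k) -> S k.+1 = S k.
  move=> nk; congr (fine (esum _ _)); apply/seteqP; split=> j [Dj /= fj].
    split=> //=; rewrite ltnS leq_eqVlt in fj; case/orP: fj => // /eqP fj.
    by exfalso; apply: nk; exists j.
  by split=> //=; exact: ltnW.
exists (S \o f); split=> [i Di|x x0 x_lt|x i j Di Dj] /=.
- split; first by rewrite -S0 S_homo.
  by rewrite -S_succ// SE; apply: sub_esum => j [].
- have [k xk] : exists k, (x < S k)%R.
    have [_ [X [finX XD] <-] xX] := ereal_sup_gt x_lt.
    exists (\max_(j <- fset_set X) f j).+1; rewrite -lte_fin SE.
    apply: lt_le_trans xX _; apply: esum_ge; exists X => //; split=> // j Xj.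
    split; first exact: XD.
    by rewrite /= ltnS; apply: leq_bigmax_seq; rewrite ?in_fset_set ?inE.
  (* For the least k = m + 1 with x < S k, [S] jumps between m and m + 1, so m is the code of the
     piece containing [x]. *)
  case: (ex_minnP (ex_intro (fun k => x < S k)%R k xk)) => -[|m] xm m_min.
    by rewrite S0 ltNge x0 in xm.
  have Sm : (S m <= x)%R by rewrite leNgt; apply/negP => /m_min; rewrite ltnn.
  have [[i Di fi]|nm] := pselect (exists2 i, D i & f i = m).
    by exists i => //=; rewrite -S_succ// fi Sm.
  by rewrite S_skip// ltNge Sm in xm.
- rewrite -!S_succ// => /andP[ix xi] /andP[jx xj].
  have [ij|ji|/f_inj] := ltngtP (f i) (f j); last by apply; rewrite inE.
  + by have := lt_le_trans xi (le_trans (S_homo _ _ ij) jx); rewrite ltxx.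
  + by have := lt_le_trans xj (le_trans (S_homo _ _ ji) ix); rewrite ltxx.
Qed.

End IntervalPacking.

(** * The path space *)

Section PathSpaceTopology.
Context {V : countType} (B : bratteli V).

Lemma countable_edges n : countable [set: edge B n].
Proof.
have -> : [set: edge B n] =
    \bigcup_(wv in [set: V * V]) edges_between B n wv.1 wv.2.
  by apply/seteqP; split=> // e _; exists (src e, rng e).
apply: bigcup_countable => [|wv _]; first exact: countableP.
exact/finite_set_countable/finite_edges.
Qed.

Lemma exists_edge_code n :
  exists f : edge B n -> nat, injective f.
Proof.
have /countable_injP[f f_inj] := countable_edges n.
by exists f => x y; apply: f_inj; rewrite inE.
Qed.

Let code n : edge B n -> nat := projT1 (cid (exists_edge_code n)).

Let code_inj n : injective (@code n).
Proof. exact: (projT2 (cid (exists_edge_code n))). Qed.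

(** Finite paths form a dependent family; sequences of edge codes replace them by one countable
    type. *)
Let coded (s : seq nat) : set (inf_path B) :=
  [set x | forall i, (i < size s)%N -> code (x i) = nth 0%N s i].

Let cylinders_coded C : cylinders C -> exists s, C = coded s.
Proof.
move=> [n [e ->]]; exists [seq code (e i) | i <- enum 'I_n.+1].
apply/seteqP; split=> x /=.
  move=> xe i; rewrite size_map size_enum_ord => ni.
  rewrite (nth_map (Ordinal ni)) ?size_enum_ord//.
  rewrite (nth_ord_enum (Ordinal ni) (Ordinal ni)).
  by rewrite (xe (Ordinal ni)).
move=> xs i; apply: code_inj.
have := xs i; rewrite size_map size_enum_ord ltn_ord => /(_ isT) ->.
by rewrite (nth_map i) ?size_enum_ord// nth_ord_enum.
Qed.

Lemma countable_cylinders : countable (@cylinders V B).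
Proof.
apply: (@sub_countable _ _ _ (range coded)); last first.
  exact: card_le_trans (card_image_le _ _) (countableP _).
by apply: subset_card_le => C /cylinders_coded[s ->]; exists s.
Qed.

Lemma open_cylinders (U : set (inf_path B)) : open U ->
  exists2 C, C `<=` @cylinders V B & U = \bigcup_(K in C) K.
Proof. by move=> [C CB <-]; exists C. Qed.

Lemma fin_path_extension n (e : fin_path B n) : exists x, cylinder e x.
Proof.
pose out i w : edge B i := projT1 (cid (out_edge B i w)).
have outE i w : src (out i w) = w by rewrite /out; case: cid.
(* The walk follows [e] up to index [n] and then takes arbitrary outgoing edges; matching on [idP]
   provides the bound from which the ordinal is built. *)
pose walk := fix walk i : edge B i :=
  if i is j.+1 then
    match @idP (j.+1 < n.+1)%N with
    | ReflectT h => e (Ordinal h)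
    | ReflectF _ => out j.+1 (rng (walk j))
    end
  else e (Ordinal (ltn0Sn n)).
have walkE i (h : (i < n.+1)%N) : walk i = e (Ordinal h).
  case: i h => [|i] h /=.
    by rewrite (bool_irrelevance h (ltn0Sn n)).
  by case: {-}_ / idP => [h'|//]; rewrite (bool_irrelevance h' h).
have adj i : rng (walk i) = src (walk i.+1).
  rewrite [walk i.+1]/=; case: {-}_ / idP => [h|h]; last by rewrite outE.
  by rewrite (walkE i (ltnW h)) fpath_adj.
by exists (InfPath adj) => -[i h]; exact: walkE.
Qed.

End PathSpaceTopology.

(** An injective code into [nat] has fibres with at most one element, so the union can be indexed by
    [nat]. *)
Lemma countable_bigcup_measurable d (T : measurableType d) (I : Type)
    (D : set I) (F : I -> set T) : countable D ->
  (forall i, D i -> measurable (F i)) -> measurable (\bigcup_(i in D) F i).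
Proof.
move=> /countable_injP[f f_inj] mF.
have -> : \bigcup_(i in D) F i =
    \bigcup_n \bigcup_(i in D `&` f @^-1` [set n]) F i.
  apply/seteqP; split=> [x [i Di Fix]|x [n _ [i [Di _] Fix]]]; last by exists i.
  by exists (f i) => //; exists i.
apply: bigcupT_measurable => n.
have [[i [Di fi]]|nD] := pselect (exists i, D i /\ f i = n); last first.
  rewrite bigcup0 // => i [Di fi].
  by exfalso; apply: nD; exists i.
rewrite (_ : _ `&` _ = [set i]) ?bigcup_set1; first exact: mF.
apply/seteqP; split=> [j [Dj /= fj]|_ ->]; last by split.
by apply: f_inj; rewrite ?inE// fj.
Qed.

Lemma pushforward_restr d d' (T1 : measurableType d) (T2 : measurableType d')
    (R : realType) (m : {measure set T1 -> \bar R}) (D : set T1)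
    (f : T1 -> T2) :
  measurable D -> measurable_fun [set: T1] f ->
  exists mu : {measure set T2 -> \bar R}, forall A, mu A = m (f @^-1` A `&` D).
Proof.
move=> mD mf.
by unshelve eexists (pushforward (mrestr m mD) f : {measure set T2 -> \bar R}).
Qed.

(** * The measure of a positive flow *)

Section PathMeasure.
Context {R : realType} {V : countType} (B : bratteli V).
Context (lambda : R) (t : V -> R).
Hypothesis lambda_gt0 : 0 < lambda.
Hypothesis t_ge0 : forall v, 0 <= t v.
Hypothesis t_flow : forall n v,
  (\esum_(e in [set e : edge B n | src e = v]) (t (rng e) / lambda ^+ n.+1)%:E
    = (t v / lambda ^+ n)%:E)%E.

Let weight n (v : V) : R := t v / lambda ^+ n.

Let weight_ge0 n v : 0 <= weight n v.
Proof. by rewrite divr_ge0// exprn_ge0// ltW. Qed.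

Let root_packing := interval_packing (countableP [set: V]) t_ge0.

(** By [t_flow], the pieces of the edges leaving [v] exactly fill an interval of length
    [weight n v]. *)
Let edge_packing n v :=
  interval_packing
    (sub_countable (subset_card_le (@subsetT _ [set e : edge B n | src e = v]))
      (countable_edges B n))
    (fun e => weight_ge0 n.+1 (rng e)).

Let root_off : V -> R := projT1 (cid root_packing).
Let edge_off n (e : edge B n) : R := projT1 (cid (edge_packing n (src e))) e.

Let total : \bar R := (\esum_(v in [set: V]) (t v)%:E)%E.

(* The first n edges of x are allotted [itv x n], with left end [left x n]. *)
Let left (x : inf_path B) n : R :=
  root_off (src (x 0%N)) + \sum_(i < n) edge_off (x i).
Let itv (x : inf_path B) n : set R :=
  [set r | left x n <= r < left x n + weight n (src (x n))].

Let itv0 x r : itv x 0 r -> 0 <= r /\ (r%:E < total)%E.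
Proof.
rewrite /itv /left /weight/= big_ord0 addr0 expr0 divr1 => /andP[rx xr].
rewrite /root_off in rx xr; move: rx xr.
case: cid => off [off_bnd _ _] /= rx xr.
have [off0 off_le] := off_bnd (src (x 0%N)) I.
by split; [exact: le_trans rx|rewrite (lt_le_trans _ off_le)// lte_fin].
Qed.

Let leftS x n : left x n.+1 = left x n + edge_off (x n).
Proof. by rewrite /left big_ord_recr/= addrA. Qed.

Let itv_sub x n : itv x n.+1 `<=` itv x n.
Proof.
move=> r; rewrite /itv/= leftS -path_adj /edge_off.
case: cid => off [off_bnd _ _] /= /andP[xr rx].
have [off0] := off_bnd (x n) erefl; rewrite t_flow lee_fin => off_le.
rewrite (le_trans _ xr) ?lerDl//= (lt_le_trans rx)// -addrA lerD2l.
exact: off_le.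
Qed.

(** By induction both paths reach the same vertex with the same left end, so their next edges belong
    to one packing, whose pieces are disjoint. *)
Let itv_inj x y r n : itv x n r -> itv y n r ->
  [/\ forall i, (i < n)%N -> x i = y i, src (x n) = src (y n) &
    left x n = left y n].
Proof.
elim: n => [|n IH] xr yr.
  have E : src (x 0%N) = src (y 0%N).
    move: xr yr; rewrite /itv/= /left !big_ord0 !addr0 /weight expr0 !divr1.
    by rewrite /root_off; case: cid => off [_ _ off_inj] /=; exact: off_inj.
  by split=> //; rewrite /left E !big_ord0.
have [xy sxy lxy] := IH (itv_sub xr) (itv_sub yr).
have shift a u w : (a + u <= r < a + u + w) = (u <= r - a < u + w).
  by rewrite lerBrDl ltrBlDl addrA.
have exy : x n = y n.
  move: xr yr; rewrite /itv/= !leftS -!path_adj lxy !shift /edge_off sxy.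
  by case: cid => off [_ _ off_inj] /=; exact: off_inj.
split=> [i||].
- by rewrite ltnS leq_eqVlt => /orP[/eqP->|/xy].
- by rewrite -!path_adj exy.
- by rewrite !leftS lxy exy.
Qed.

Let itinerary_exists r : 0 <= r -> (r%:E < total)%E ->
  exists x : inf_path B, forall n, itv x n r.
Proof.
move=> r0 r_lt.
have [v0 v0r] : exists v, root_off v <= r < root_off v + t v.
  rewrite /root_off; case: cid => off [_ off_cover _] /=.
  by have [v] := off_cover r r0 r_lt; exists v.
(* Stated as an implication, so that the choice of an edge is total and the invariant can be proved
   after the recursion. *)
have next n v a : exists e : edge B n, src e = v /\
    (a <= r < a + weight n v ->
     a + edge_off e <= r < a + edge_off e + weight n.+1 (rng e)).
  have [ar|ar] := pselect (a <= r < a + weight n v); last first.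
    by have [e ev] := out_edge B n v; exists e; split.
  suff [e ev er] : exists2 e : edge B n, src e = v &
      projT1 (cid (edge_packing n v)) e <= r - a <
      projT1 (cid (edge_packing n v)) e + weight n.+1 (rng e).
    exists e; split=> // _; move: er; rewrite /edge_off ev.
    by rewrite lerBrDl ltrBlDl addrA.
  case: cid => off [_ off_cover _] /=; apply: off_cover.
    by rewrite subr_ge0; case/andP: ar.
  by rewrite t_flow lte_fin ltrBlDl; case/andP: ar.
pose nx n (s : V * R) : edge B n := projT1 (cid (next n s.1 s.2)).
(* The state is the current vertex together with the left end of the current interval. *)
pose st := fix st n : V * R :=
  if n is m.+1 then (rng (nx m (st m)), (st m).2 + edge_off (nx m (st m)))
  else (v0, root_off v0).
have nx_src n : src (nx n (st n)) = (st n).1.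
  by rewrite /nx; case: cid => e [].
have nx_itv n s : s.2 <= r < s.2 + weight n s.1 ->
    s.2 + edge_off (nx n s) <= r <
    s.2 + edge_off (nx n s) + weight n.+1 (rng (nx n s)).
  by rewrite /nx; case: cid => e [].
have adj n : rng (nx n (st n)) = src (nx n.+1 (st n.+1)) by rewrite nx_src.
pose x := InfPath adj.
have st_left n : left x n = (st n).2.
  elim: n => [|n IH]; first by rewrite /left big_ord0 addr0 nx_src.
  by rewrite leftS IH.
exists x => n; rewrite /itv/= st_left nx_src.
elim: n => [|n IH]; first by rewrite /weight expr0 divr1.
exact: nx_itv IH.
Qed.

Let D : set R := [set r | 0 <= r /\ (r%:E < total)%E].

(** The value [point] off [D] only makes the map total: Lebesgue measure is restricted to [D] before
    being transported. *)
Let phi_exists : exists phi : R -> inf_path B,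
  (forall r, D r -> forall n, itv (phi r) n r) /\
  (forall r, ~ D r -> phi r = point).
Proof.
have phiP r : exists x : inf_path B,
    (D r -> forall n, itv x n r) /\ (~ D r -> x = point).
  have [[r0 r_lt]|Dr] := pselect (D r); last by exists point; split.
  by have [x xr] := itinerary_exists r0 r_lt; exists x; split=> // -[].
have [phi phiE] := choice phiP.
by exists phi; split=> r; case: (phiE r).
Qed.

Let D_itv : exists2 i : interval R, D = [set` i] &
  lebesgue_measure ([set` i] : set R) = total.
Proof.
have total0 : (0 <= total)%E by apply: esum_ge0 => v _; rewrite lee_fin.
case E : total total0 => [T| |//] T0.
  exists `[0, T[.
    apply/seteqP; split=> r /=; rewrite in_itv/= /D/= E lte_fin.
      by case=> -> ->.
    by move=> /andP[-> ->].
  rewrite lebesgue_measure_itv/= lte_fin sube0.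
  by move: T0; rewrite lee_fin le_eqVlt => /orP[/eqP<-|->]; rewrite ?ltxx.
exists `[0, +oo[; last by rewrite lebesgue_measure_itv/= ltry.
apply/seteqP; split=> r /=; rewrite in_itv/= andbT /D/= E ltry; first by case.
by move=> ->.
Qed.

Let D_measurable : measurable (D : set (measurableTypeR R)).
Proof. by have [i -> _] := D_itv; exact: measurable_itv. Qed.

Let lebesgue_D : lebesgue_measure D = total.
Proof. by have [i ->] := D_itv. Qed.

Lemma path_measure_exists : exists mu : {measure set (borel_path B) -> \bar R},
  PF_measure lambda t mu /\ mu [set: borel_path B] = total.
Proof.
have [phi [phi_itv phi_pt]] := phi_exists.
have phi_cylinder n (e : fin_path B n) : exists a : R,
    phi @^-1` (cylinder e) `&` D =
      [set` `[a, a + weight n.+1 (terminal e)[ ].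
  (* Any extension [x] of [e] serves, because [itv x n.+1] depends only on the n + 1 edges of
     [e]. *)
  have [x xe] := fin_path_extension e.
  have srcE (y : inf_path B) : cylinder e y -> src (y n.+1) = terminal e.
    by move=> ye; rewrite -path_adj (ye ord_max).
  exists (left x n.+1); apply/seteqP; split=> r /=.
    move=> [phie Dr]; have := phi_itv r Dr n.+1.
    rewrite /itv/= srcE// in_itv/= /left.
    rewrite (phie ord0) (xe ord0).
    by under eq_bigr do rewrite phie -xe.
  rewrite in_itv/= -(srcE x)// => xr.
  have [r0 r_lt] : 0 <= r /\ (r%:E < total)%E.
    apply: (@itv0 x); elim: n.+1 xr => // m IH /itv_sub; exact: IH.
  split=> // i; have [phix _ _] := itv_inj (phi_itv r (conj r0 r_lt) n.+1) xr.
  by rewrite phix// xe.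
have phi_D_measurable (U : set (inf_path B)) : open U ->
    measurable (phi @^-1` U `&` D : set (measurableTypeR R)).
  move=> /open_cylinders[C Ccyl ->]; rewrite preimage_bigcup setI_bigcupl.
  apply: countable_bigcup_measurable => [|K /Ccyl[n [e ->]]].
    exact: sub_countable (subset_card_le Ccyl) (countable_cylinders B).
  by have [a ->] := phi_cylinder n e; exact: measurable_itv.
have phi_measurable :
    measurable_fun [set: measurableTypeR R] (phi : _ -> borel_path B).
  apply: (measurability (@open (inf_path B) : set (set (borel_path B))))
    => // _ [U oU <-].
  (* Off [D] the map is constant, so that part of the preimage is the complement of [D] or empty. *)
  rewrite setTI (_ : _ @^-1` _ =
      (phi @^-1` U `&` D) `|` (phi @^-1` U `&` ~` D)); last first.
    by rewrite -setIUr setUCr setIT.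
  apply: measurableU; first exact: phi_D_measurable.
  have [Up|Up] := pselect (U point).
    rewrite (_ : _ `&` _ = ~` D); first exact: measurableC.
    by apply/seteqP; split=> [r []//|r Dr]; split=> //=; rewrite phi_pt.
  rewrite (_ : _ `&` _ = set0)//.
  by apply/seteqP; split=> // r [/= + Dr]; rewrite phi_pt.
have [mu muE] := pushforward_restr lebesgue_measure D_measurable phi_measurable.
exists mu; split=> [n e|]; rewrite muE; last first.
  by rewrite preimage_setT setTI; exact: lebesgue_D.
have [a ea] := phi_cylinder n e.
transitivity
  (lebesgue_measure ([set` `[a, a + weight n.+1 (terminal e)[] : set R)).
  by congr lebesgue_measure.
rewrite lebesgue_measure_itv/= lte_fin ltrDl.
(* The length formula tests whether the interval is non-degenerate, so a zero weight is treated
   apart. *)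
have := weight_ge0 n.+1 (terminal e); rewrite le_eqVlt => /orP[/eqP w0|->].
  by rewrite -w0 ltxx -/(weight _ _) -w0.
by rewrite -EFinB addrAC subrr add0r.
Qed.

End PathMeasure.

(** * From the eigenvector equation to a flow on the edges *)

Section StationaryDiagram.
Context {R : realType} {V : countType} (B : bratteli V) (F : V -> V -> nat).
Hypothesis B_F : stationary B F.

(** The edges leaving [v] are grouped by their range [w]; each group has [F w v] elements, whence
    the transpose. *)
Lemma esum_out_edges n v (u : V -> R) : (forall w, 0 <= u w) ->
  (\esum_(e in [set e : edge B n | src e = v]) (u (rng e))%:E =
   \esum_(w in [set: V]) (transpose (real_matrix F) v w * u w)%:E)%E.
Proof.
move=> u0.
transitivity (\esum_(w in [set: V]) \esum_(e in edges_between B n v w)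
    (u (rng e))%:E)%E.
  rewrite esum_esum => [|w e _ _]; last by rewrite lee_fin.
  rewrite (reindex_esum [set e : edge B n | src e = v] _
    (fun e => (rng e, e)))//.
  split=> [e //=|e e' _ _ [_ ->//]|[w e] [_ [/= ev ew]]].
  by exists e => //; rewrite ew.
apply: eq_esum => w _; rewrite esum_fset; last 2 first.
- exact: finite_edges.
- by move=> e _; rewrite lee_fin.
rewrite (eq_fsbigr (fun=> (u w)%:E)); last by move=> e /set_mem[_ ->].
rewrite fsbig_finite/=; last exact: finite_edges.
rewrite sumEFin big_const_seq count_predT iter_addr_0 /transpose /real_matrix.
by rewrite -(B_F n w v) mulr_natl.
Qed.

Lemma real_matrix_finite_row w :
  finite_set [set v | real_matrix (R := R) F w v != 0].
Proof.
apply: sub_finite_set (finite_rows B 0 w) => v /=.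
by rewrite /real_matrix pnatr_eq0 B_F.
Qed.

(** This is the equation of the eigenvector at [v], divided by lambda^(n+1). *)
Lemma PF_right_eigenvector_flow (lambda : R) (t : V -> R) : 0 < lambda ->
  PF_right_eigenvector (transpose (real_matrix F)) lambda t -> forall n v,
  (\esum_(e in [set e : edge B n | src e = v]) (t (rng e) / lambda ^+ n.+1)%:E
    = (t v / lambda ^+ n)%:E)%E.
Proof.
move=> l0 [t0 tE] n v.
have l_ge0 : 0 <= (lambda ^+ n.+1)^-1 by rewrite invr_ge0 exprn_ge0// ltW.
rewrite (@esum_out_edges n v (fun w => t w / lambda ^+ n.+1)); last first.
  by move=> w; rewrite mulr_ge0// ltW.
transitivity ((lambda ^+ n.+1)^-1%:E *
    \esum_(w in [set: V]) (transpose (real_matrix F) v w * t w)%:E)%E.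
  rewrite -esumZl// => [|w]; last by rewrite lee_fin mulr_ge0 ?ler0n// ltW.
  by apply: eq_esum => w _; rewrite -EFinM mulrA mulrC.
rewrite tE -EFinM exprS invfM mulrACA mulVf ?mul1r; last by rewrite gt_eqF.
by rewrite mulrC.
Qed.

End StationaryDiagram.

Theorem theorem2p20 (R : realType) (V : countType) (B : bratteli V)
    (F : V -> V -> nat) (hBF : stationary B F) (lambda : R)
    (hirr : irreducible (@real_matrix R V F))
    (haper : aperiodic (@real_matrix R V F))
    (hlambda : PF_eigenvalue (@real_matrix R V F) lambda)
    (hrec : recurrent (@real_matrix R V F) lambda) :
  exists mu : {measure set (borel_path B) -> \bar R},
    [/\ tail_invariant mu,
        (exists t : V -> R,
           PF_right_eigenvector (transpose (@real_matrix R V F)) lambda t /\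
           PF_measure lambda t mu)
      & forall t : V -> R,
          PF_right_eigenvector (transpose (@real_matrix R V F)) lambda t ->
          ((mu [set: borel_path B] < +oo)%E <->
           (\esum_(v in [set: V]) (t v)%:E < +oo)%E)].
Proof.
have F_ge0 i j : 0 <= @real_matrix R V F i j by exact: ler0n.
have l0 := PF_eigenvalue_gt0 F_ge0 hrec hlambda.
have [t tE] := PF_right_eigenvector_exists F_ge0 hirr hrec hlambda
  (real_matrix_finite_row hBF).
have [mu [mu_t mu_T]] := path_measure_exists l0 (fun v => ltW (tE.1 v))
  (PF_right_eigenvector_flow hBF l0 tE).
exists mu; split=> [n e e' ee'||t' t'E].
- by rewrite !mu_t ee'.
- by exists t.
(* The total mass is the sum of the [t] used in the construction; passing to an arbitrary
   eigenvector [t'] is the comparison of eigenvectors. *)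
- rewrite mu_T.
  by split; exact: (PF_right_eigenvector_summable F_ge0 hirr hrec hlambda).
Qed.
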